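(* Let $M=(\Sigma,A_{S_0},T_R)$ be a regular system, $LEP=\{\ell ep_1,\dots,\ell ep_k\}$ a set of local execution properties, $\ell osp$ a local-oriented system property over $LEP$, and $M^a_{\neg\ell osp}=(\Sigma^a,A^a_{S_0},T^a_R,F^a)$ the Büchi regular system constructed from them as described in the context. Then: (a) for every accepting execution $\pi^a=\pi^a(0)\pi^a(1)\cdots$ of $M^a_{\neg\ell osp}$, the sequence $\pi=w_0w_1\cdots$ with $w_i=\Pi_\Sigma(\pi^a(i))$ is an execution of $M$ that does not satisfy $\ell osp$; and (b) for every execution $\pi=w_0w_1\cdots$ of $M$ that does not satisfy $\ell osp$, there is an accepting execution $\pi^a$ of $M^a_{\neg\ell osp}$ with $\Pi_\Sigma(\pi^a(i))=w_i$ for all $i$.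
   Context: A regular system $M=(\Sigma,A_{S_0},T_R)$ consists of a finite alphabet $\Sigma$, a deterministic finite-word automaton $A_{S_0}$ over $\Sigma$ (initial states $L(A_{S_0})$) and a deterministic finite-word transducer $T_R=(Q_R,\Sigma\times\Sigma,q_{0R},\delta_R,F_R)$ representing the relation $R$ of equal-length pairs $(u,v)$ with $(u(0),v(0))\cdots(u(n-1),v(n-1))$ accepted. An execution of $M$ is an infinite sequence $\pi=w_0w_1\cdots$ with $w_0\in L(A_{S_0})$ and $(w_i,w_{i+1})\in R$ (all executions assumed infinite); all $w_i$ then have a common length $n$. For $0\le j<n$ the $j$-th local projection is the infinite word $\Pi_j(\pi)=w_0(j)w_1(j)w_2(j)\cdots$. A local execution property is a set $\ell ep\subseteq\Sigma^\omega$; each $\ell ep_i$ is recognized by a complete Büchi automaton $A_{\ell ep_i}=(Q_{\ell ep_i},\Sigma,q_{0,\ell ep_i},\Delta_{\ell ep_i},F_{\ell ep_i})$, and $A_{\neg\ell ep_i}=(Q_{\neg\ell ep_i},\Sigma,q_{0,\neg\ell ep_i},\Delta_{\neg\ell ep_i},F_{\neg\ell ep_i})$ is a complete Büchi automaton recognizing $\Sigma^\omega\setminus\ell ep_i$. For $x\in\Sigma^\omega$, $\mathbf{lep}(x)=\{\ell ep_i\mid x\in\ell ep_i\}$. A local-oriented system property is a set $\ell osp\subseteq(2^{LEP})^*$ recognized by a finite-word automaton; an execution $\pi$ satisfies $\ell osp$ iff $\mathbf{lep}(\Pi_0(\pi))\cdots\mathbf{lep}(\Pi_{n-1}(\pi))\in\ell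 osp$. Construction: $\Sigma^a=\Sigma\times\prod_{i=1}^kQ_{\ell ep_i}\times\prod_{i=1}^kQ_{\neg\ell ep_i}\times2^{LEP}\times2^{LEP}\times\{reset,noreset\}$, with $\Pi_\Sigma$ the letterwise projection onto $\Sigma$. The transducer $T^a_R$ has state set $Q_R$, initial state $q_{0R}$, accepting states $F_R$, and a transition from $q$ to $q'$ on the letter pair $((a_1,p_1,\dots,p_k,\bar p_1,\dots,\bar p_k,L_1,G_1,\rho_1),(a_2,p_1',\dots,p_k',\bar p_1',\dots,\bar p_k',L_2,G_2,\rho_2))$ iff: $q'\in\delta_R(q,(a_1,a_2))$; $p_i'\in\Delta_{\ell ep_i}(p_i,a_1)$ and $\bar p_i'\in\Delta_{\neg\ell ep_i}(\bar p_i,a_1)$ for $1\le i\le k$; $L_1=L_2$; and if $G_1=LEP$ then either ($G_2=\emptyset$ and $\rho_2=reset$) or ($G_2=G_1$ and $\rho_2=noreset$), while otherwise $G_2=G_1\cup\{\ell ep_i\in L_1\mid p_i\in F_{\ell ep_i}\}\cup\{\ell ep_i\notin L_1\mid\bar p_i\in F_{\neg\ell ep_i}\}$ and $\rho_2=noreset$. $R^a$ is the set of equal-length word pairs over $\Sigma^a$ accepted by $T^a_R$. The initial states $L(A^a_{S_0})$ are the words whose $j$-th letter ($0\le j<n$) is $(w(j),q_{0,\ell ep_1},\dots,q_{0,\ell ep_k},q_{0,\neg\ell ep_1},\dots,q_{0,\neg\ell ep_k},L^{(j)},\emptyset,noreset)$, where $w(0)\cdots w(n-1)\in L(A_{S_0})$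 and $L^{(0)}\cdots L^{(n-1)}\in(2^{LEP})^*\setminus\ell osp$. $L(F^a)$ is the set of words over $\Sigma^a$ all of whose letters have last component $reset$. An execution of $M^a_{\neg\ell osp}$ is an infinite sequence $w^a_0w^a_1\cdots$ with $w^a_0\in L(A^a_{S_0})$ and $(w^a_i,w^a_{i+1})\in R^a$; it is accepting if $w^a_i\in L(F^a)$ for infinitely many $i$. *)

(* Defs.v *)
From HB Require Import structures.
From mathcomp Require Import all_boot.
From mathcomp Require Import boolp classical_sets.

Set Implicit Arguments.
Unset Strict Implicit.
Unset Printing Implicit Defensive.

Local Open Scope classical_set_scope.

(* One tuple (Q, Sigma, q0, Delta, F) serves for finite-word automata, for
   Buchi automata, and, over the alphabet Sigma * Sigma, for transducers. *)
Record automaton (Sigma : finType) := Automaton {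
  state : finType;
  start : state;
  trans : state -> Sigma -> {set state};
  final : {set state}
}.

Section Automata.
Variable Sigma : finType.
Implicit Type A : automaton Sigma.

Definition deterministic A := forall (q : state A) a, #|trans q a| <= 1.

Definition complete A := forall (q : state A) a, trans q a != finset.set0.

Fixpoint accepts A (q : state A) (s : seq Sigma) : bool :=
  if s is a :: s' then [exists q' in trans q a, accepts q' s']
  else q \in final A.

Definition lang A : set (seq Sigma) := [set s | accepts (start A) s].

Definition infinitely_often (P : nat -> Prop) :=
  forall m, exists2 i, m <= i & P i.

Definition omega_lang A : set (nat -> Sigma) :=
  [set x | exists r : nat -> state A,
    [/\ r 0 = start A,
        forall i, r i.+1 \in trans (r i) (x i)
      & infinitely_often (fun i => r i \in final A)]].

End Automata.

Section Executions.
Variable Sigma : finType.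

Definition relation_of (T : automaton (Sigma * Sigma)%type)
    (u v : seq Sigma) : Prop :=
  size u = size v /\ lang T (zip u v).

Definition execution (S0 : set (seq Sigma)) (R : seq Sigma -> seq Sigma -> Prop)
    (w : nat -> seq Sigma) : Prop :=
  S0 (w 0) /\ forall i, R (w i) (w i.+1).

(* In an execution all words have the length of [w 0], so the default value
   given to [nth] is never used. *)
Definition local_proj (w : nat -> seq Sigma) (j : 'I_(size (w 0))) :
    nat -> Sigma :=
  fun i => nth (tnth (in_tuple (w 0)) j) (w i) j.

End Executions.

Record regular_system (Sigma : finType) := RegularSystem {
  rs_init : automaton Sigma;
  rs_trans : automaton (Sigma * Sigma)%type;
  rs_init_det : deterministic rs_init;
  rs_trans_det : deterministic rs_trans
}.

Definition rs_execution (Sigma : finType) (M : regular_system Sigma) :=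
  execution (lang (rs_init M)) (relation_of (rs_trans M)).

(* A Buchi regular system, given by the languages of its automata of initial
   and of accepting words. *)
Record buchi_system (Sigma : finType) := BuchiSystem {
  bs_init : set (seq Sigma);
  bs_trans : automaton (Sigma * Sigma)%type;
  bs_final : set (seq Sigma)
}.

Definition bs_execution (Sigma : finType) (M : buchi_system Sigma) :=
  execution (bs_init M) (relation_of (bs_trans M)).

Definition bs_accepting (Sigma : finType) (M : buchi_system Sigma)
    (w : nat -> seq Sigma) :=
  infinitely_often (fun i => bs_final M (w i)).

(* The properties lep_1, ..., lep_k are designated by their indices in 'I_k,
   so that 2^LEP is {set 'I_k} and LEP is [set: 'I_k]. *)
Section LocalProperties.
Variables (Sigma : finType) (k : nat) (lep : 'I_k -> set (nat -> Sigma)).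

Definition lep_set (x : nat -> Sigma) : {set 'I_k} :=
  [set i | `[< lep i x >]]%SET.

Definition lep_word (w : nat -> seq Sigma) : seq {set 'I_k} :=
  [seq lep_set (local_proj j) | j <- enum 'I_(size (w 0))].

Definition satisfies (losp : set (seq {set 'I_k})) (w : nat -> seq Sigma) :=
  losp (lep_word w).

End LocalProperties.

Section Construction.
Variables (Sigma : finType) (k : nat).
Variables (A nA : 'I_k -> automaton Sigma).

Definition aug_letter : finType :=
  (Sigma * {dffun forall i, state (A i)} * {dffun forall i, state (nA i)}
   * {set 'I_k} * {set 'I_k} * bool)%type.

Definition reset := true.
Definition noreset := false.

Definition proj_letter (x : aug_letter) : Sigma :=
  let: (a, _, _, _, _, _) := x in a.

Definition flag (x : aug_letter) : bool := let: (_, _, _, _, _, r) := x in r.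

Definition proj_word (s : seq aug_letter) : seq Sigma := map proj_letter s.

Definition start_letter (a : Sigma) (L : {set 'I_k}) : aug_letter :=
  (a, [ffun i => start (A i)], [ffun i => start (nA i)], L, finset.set0,
   noreset).

Definition aug_step (x y : aug_letter) : bool :=
  let: (a1, p1, np1, L1, G1, _) := x in
  let: (_, p2, np2, L2, G2, r2) := y in
  [&& [forall i, p2 i \in trans (p1 i) a1],
      [forall i, np2 i \in trans (np1 i) a1],
      L1 == L2
    & if G1 == [set: 'I_k]%SET then
        ((G2 == finset.set0) && (r2 == reset))
        || ((G2 == G1) && (r2 == noreset))
      else
        (G2 == (G1 :|: [set i in L1 | p1 i \in final (A i)]
                   :|: [set i | (i \notin L1) && (np1 i \in final (nA i))])%SET)
        && (r2 == noreset)].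

Definition aug_transducer (T : automaton (Sigma * Sigma)%type) :
    automaton (aug_letter * aug_letter)%type :=
  {| state := state T;
     start := start T;
     trans := fun q xy =>
       [set q' in trans q (proj_letter xy.1, proj_letter xy.2)
             | aug_step xy.1 xy.2]%SET;
     final := final T |}.

Definition aug_init (S0 : set (seq Sigma)) (losp : set (seq {set 'I_k})) :
    set (seq aug_letter) :=
  [set s | exists w L, [/\ S0 w, (~` losp) L, size w = size L
                         & s = [seq start_letter x.1 x.2 | x <- zip w L]]].

Definition aug_final : set (seq aug_letter) :=
  [set s | all (fun x => flag x == reset) s].

Definition aug_system (M : regular_system Sigma)
    (losp : set (seq {set 'I_k})) : buchi_system aug_letter :=
  {| bs_init := aug_init (lang (rs_init M)) losp;
     bs_trans := aug_transducer (rs_trans M);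
     bs_final := aug_final |}.

End Construction.

(* Main.v *)
(** Column [j] of an augmented word runs the automata on the local projection
    [j] under a guess [L] for its set of local properties, and accumulates in
    [G] the properties whose guess has been confirmed by an accepting state
    since the last reset.  A reset needs [G] to be full and empties it, so
    infinitely many resets are possible exactly when every selected run visits
    its accepting states infinitely often, that is, when the guess is right. *)
Require Import Defs.
From mathcomp Require Import all_boot.
From mathcomp Require Import boolp classical_sets.

Local Open Scope classical_set_scope.

(** * Preliminaries on infinite recurrence and runs of complete automata *)

Lemma all2_map_same {S T U : Type} (r : S -> T -> bool) (f : U -> S)
    (g : U -> T) (s : seq U) :
  all2 r (map f s) (map g s) = all (fun u => r (f u) (g u)) s.
Proof. by elim: s => //= u s ->. Qed.

Lemma not_infinitely_often {P : nat -> Prop} :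
  ~ infinitely_often P -> exists m, forall t, m <= t -> ~ P t.
Proof.
move=> nP; apply: contrapT => nm; apply: nP => m; apply: contrapT => nt.
by apply: nm; exists m => t mt Pt; apply: nt; exists t.
Qed.

Lemma complete_run {Sigma : finType} (A : automaton Sigma) (x : nat -> Sigma) :
  complete A -> exists r : nat -> state A,
    r 0 = start A /\ forall t, r t.+1 \in trans (r t) (x t).
Proof.
move=> cA.
have /choice[f fP] : forall qa : state A * Sigma,
    exists q', q' \in trans qa.1 qa.2.
  by move=> [q a]; apply/set0Pn/cA.
exists (fix r t := if t is t'.+1 then f (r t', x t') else start A).
by split=> // t; apply: fP (_, _).
Qed.

(** * Executions seen as families of columns *)

Section Columns.
Context {Sigma : Type}.

(** The position type ['I_n] does not vary with [t], so the local projection at [j] becomes the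
    plain function [x^~ j]. *)
Definition columns {n} (x : nat -> 'I_n -> Sigma) (t : nat) : seq Sigma :=
  [seq x t j | j <- enum 'I_n].

Lemma columns_of (w : nat -> seq Sigma) :
  (forall t, size (w t) = size (w t.+1)) ->
  exists x : nat -> 'I_(size (w 0)) -> Sigma, w = columns x.
Proof.
move=> sz.
have szw t : size (w t) = size (w 0) by elim: t => // t <-.
exists (fun t j => tnth (in_tuple (w t)) (cast_ord (esym (szw t)) j)).
(* [Sigma] may be empty, so the default letter for [nth] has to come from [w t] itself; the empty
   word is treated apart. *)
apply/funext => t; case: {2}(w t) (erefl (w t)) => [|a s] wt.
  have sz0 : size (enum 'I_(size (w 0))) = 0.
    by rewrite size_enum_ord -(szw t) wt.
  by rewrite wt /columns; move/size0nil: sz0 => ->.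
apply: (@eq_from_nth _ a) => [|i ilt]; first by rewrite size_map size_enum_ord.
have ilt0 : i < size (w 0) by rewrite -(szw t).
rewrite (nth_map (Ordinal ilt0)) ?size_enum_ord // (tnth_nth a) /=.
by rewrite nth_enum_ord.
Qed.

End Columns.

(** The two sides enumerate ['I_(size (columns x 0))] and ['I_n], equal only by a provable equation,
    hence the comparison entry by entry. *)
Lemma lep_word_columns {Sigma : finType} {k n : nat}
    (lep : 'I_k -> set (nat -> Sigma)) (x : nat -> 'I_n -> Sigma) :
  lep_word lep (columns x) = [seq lep_set lep (x^~ j) | j <- enum 'I_n].
Proof.
have szw : size (columns x 0) = n by rewrite /columns size_map size_enum_ord.
apply: (@eq_from_nth _ finset.set0) => [|i].
  by rewrite /lep_word 2!size_map !size_enum_ord.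
rewrite size_map size_enum_ord => ilt.
have iltn : i < n by rewrite -szw.
rewrite (nth_map (Ordinal ilt)) ?size_enum_ord //.
rewrite (nth_map (Ordinal iltn)) ?size_enum_ord //; congr lep_set.
apply/funext => t; rewrite /local_proj nth_enum_ord //.
rewrite (nth_map (Ordinal iltn)) ?size_enum_ord //; congr x.
Qed.

Lemma execution_columns {Sigma : finType} {S0 : set (seq Sigma)}
    {T : automaton (Sigma * Sigma)%type} {w : nat -> seq Sigma} :
  execution S0 (relation_of T) w ->
  exists n, exists x : nat -> 'I_n -> Sigma, w = columns x.
Proof.
by case=> _ R; exists (size (w 0)); apply: columns_of => t; case: (R t).
Qed.

(** * Steps of the augmented transducer *)

Section AugmentedLetters.
Context {Sigma : finType} {k : nat} {A nA : 'I_k -> automaton Sigma}.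
Implicit Types (x y : aug_letter A nA) (u v : seq (aug_letter A nA)).

Definition pos_states x : {dffun forall i, state (A i)} := x.1.1.1.1.2.
Definition neg_states x : {dffun forall i, state (nA i)} := x.1.1.1.2.
Definition guess x : {set 'I_k} := x.1.1.2.
Definition collected x : {set 'I_k} := x.1.2.

(** The two sets that [aug_step] adds to [G1], merged into one: the guess decides which of the two
    automata must accept. *)
Definition confirmed x : {set 'I_k} :=
  [set i | if i \in guess x then pos_states x i \in final (A i)
           else neg_states x i \in final (nA i)]%SET.

Lemma aug_stepE x y :
  aug_step x y =
  [&& [forall i, pos_states y i \in trans (pos_states x i) (proj_letter x)],
      [forall i, neg_states y i \in trans (neg_states x i) (proj_letter x)],
      guess x == guess y
    & if collected x == [set: 'I_k]%SET then
        ((collected y == finset.set0) && flag y)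
        || ((collected y == collected x) && ~~ flag y)
      else (collected y == (collected x :|: confirmed x)%SET) && ~~ flag y].
Proof.
case: x => [[[[[a p] np] L] G] r]; case: y => [[[[[b q] nq] L'] G'] r'].
rewrite /aug_step /pos_states /neg_states /guess /collected /=.
rewrite /reset /noreset eqb_id eqbF_neg -finset.setUA.
congr [&& _, _, _ & if _ then _ else (_ == _ :|: _)%SET && _].
by apply/setP => i; rewrite !inE /=; case: (i \in L) => //=; rewrite orbF.
Qed.

(** The test [aug_step] does not involve the transducer's state, so it factors out of the
    existential over successors, letter by letter. *)
Lemma relation_of_aug_transducer (T : automaton (Sigma * Sigma)%type) u v :
  relation_of (aug_transducer A nA T) u v <->
  relation_of T (proj_word u) (proj_word v) /\ all2 (@aug_step _ _ A nA) u v.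
Proof.
have acc (q : state T) s s' : size s = size s' ->
    accepts (A := aug_transducer A nA T) q (zip s s') =
    accepts (A := T) q (zip (proj_word s) (proj_word s'))
      && all2 (@aug_step _ _ A nA) s s'.
  elim: s s' q => [|x s IH] [|y s'] q //=; first by rewrite andbT.
  case=> /IH {}IH; apply/existsP/andP => [[q'] | [/existsP[q']]].
    rewrite inE IH -!andbA => /and4P[xq xy acc ss]; rewrite xy ss; split=> //.
    by apply/existsP; exists q'; rewrite xq.
  case/andP=> xq acc /andP[xy ss]; exists q'.
  by rewrite inE IH xq xy acc ss.
split=> [[sz]|[[sz Tuv] uv]].
  by rewrite /lang/= acc // => /andP[Tuv ->]; split=> //; split; rewrite ?size_map.
by rewrite !size_map in sz; split=> //; rewrite /lang/= acc // uv andbT.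
Qed.

(** * Soundness of the guess in a single column *)

Section Column.
Variable x : nat -> aug_letter A nA.
Hypothesis x_step : forall t, aug_step (x t) (x t.+1).

Lemma guess_const t : guess (x t) = guess (x 0).
Proof.
by elim: t => // t <-; have := x_step t; rewrite aug_stepE => /and4P[_ _ /eqP->].
Qed.

(** If [i] were unconfirmed from [m] on, the first reset found beyond [m] would empty the collected
    set, [i] would stay missing, and no later reset could occur. *)
Lemma confirmed_infinitely_often i :
  infinitely_often (fun t => flag (x t)) ->
  infinitely_often (fun t => i \in confirmed (x t)).
Proof.
move=> resets; apply: contrapT => /not_infinitely_often[m unconf].
(* Asking for [m.+1] makes the reset time a successor [s.+1] with [m <= s], so the step out of [x s]
   is the one that resets. *)
have [[|s] // ms rs] := resets m.+1.
have unfull t :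
    i \notin collected (x t) -> collected (x t) == finset.setT = false.
  by apply: contraNF => /eqP->; rewrite inE.
have missing t : s < t -> i \notin collected (x t).
  elim: t => // t IH; rewrite ltnS leq_eqVlt => /predU1P[<-|st].
    have := x_step s; rewrite aug_stepE => /and4P[_ _ _].
    by case: ifP => _; rewrite rs /= ?andbT ?andbF ?orbF // => /eqP->; rewrite inE.
  have it := IH st; have := x_step t; rewrite aug_stepE => /and4P[_ _ _].
  rewrite unfull // => /andP[/eqP-> _]; rewrite inE negb_or it.
  by apply/negP/unconf; rewrite (leq_trans _ (ltnW st)).
(* A second reset, at [t.+1] with [s < t], would need a full set at [t], where [i] is missing. *)
have [[|t] // st rt] := resets s.+2.
have := x_step t; rewrite aug_stepE => /and4P[_ _ _].
by rewrite unfull ?missing // rt andbF.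
Qed.

(** A guessed property has an accepting run of [A i]; an unguessed one has an accepting run of
    [nA i], which recognizes the complement. Neither kind of error is possible. *)
Lemma lep_set_guess (lep : 'I_k -> set (nat -> Sigma)) :
  (forall i, omega_lang (A i) = lep i) ->
  (forall i, omega_lang (nA i) = ~` lep i) ->
  (exists a L, x 0 = start_letter A nA a L) ->
  infinitely_often (fun t => flag (x t)) ->
  lep_set lep (fun t => proj_letter (x t)) = guess (x 0).
Proof.
move=> A_lep nA_lep [a [L x0]] resets.
apply/setP => i; rewrite inE.
have inf := confirmed_infinitely_often i resets.
have [iL|iL] := boolP (i \in guess (x 0)).
  apply/asboolP; rewrite -A_lep; exists (fun t => pos_states (x t) i).
  split=> [|t|m]; first by rewrite x0 /pos_states ffunE.
    by have := x_step t; rewrite aug_stepE => /and4P[/forallP/(_ i)].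
  by have [t mt] := inf m; rewrite inE guess_const iL; exists t.
apply/asboolPn; change ((~` lep i) (fun t => proj_letter (x t))).
rewrite -nA_lep; exists (fun t => neg_states (x t) i).
split=> [|t|m]; first by rewrite x0 /neg_states ffunE.
  by have := x_step t; rewrite aug_stepE => /and4P[_ /forallP/(_ i)].
by have [t mt] := inf m; rewrite inE guess_const (negPf iL); exists t.
Qed.

End Column.

(** * Simultaneous resets of all columns *)

Section Synchronized.
Context {n : nat} (conf : nat -> 'I_n -> {set 'I_k}).

(* All columns wait for the last one to be full, so that they reset together. *)
Fixpoint collect (t : nat) : 'I_n -> {set 'I_k} :=
  if t is t'.+1 then
    fun j => if [forall l, collect t' l == finset.setT] then finset.set0
             else (collect t' j :|: conf t' j)%SET
  else fun=> finset.set0.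

(** Without a full moment after [m], nothing is emptied and the sets only grow; each of the finitely
    many pairs of a column and a property enters at some time, so all are present at the latest of
    these times. *)
Lemma collect_full_infinitely_often :
  (forall j i, infinitely_often (fun t => i \in conf t j)) ->
  infinitely_often (fun t => [forall l, collect t l == finset.setT]).
Proof.
move=> inf; apply: contrapT => /not_infinitely_often[m unfull].
have mono t s j i : m <= t -> i \in collect t j -> i \in collect (t + s) j.
  move=> mt it; elim: s => [|s IH]; first by rewrite addn0.
  rewrite addnS /= ifF ?inE ?IH //; apply/negP/unfull.
  by rewrite (leq_trans mt) ?leq_addr.
have /choice[f fP] : forall ji : 'I_n * 'I_k, exists t,
    m <= t /\ ji.2 \in collect t ji.1.
  move=> [j i]; have [t mt it] := inf j i m; exists t.+1; rewrite leqW //=.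
  by rewrite ifF ?inE ?it ?orbT //; apply/negP/unfull.
(* Adding [m] guarantees [m <= N] even when there are no pairs and the maximum is [0]. *)
pose N := m + \max_ji f ji.
apply: (unfull N); first exact: leq_addr.
apply/forallP => j; rewrite -finset.subTset; apply/fintype.subsetP => i _.
have [mf fi] := fP (j, i).
have leN : f (j, i) <= N by rewrite (leq_trans (leq_bigmax (j, i))) ?leq_addl.
by rewrite -(subnKC leN) mono.
Qed.

End Synchronized.

End AugmentedLetters.

(** * Construction of accepting augmented columns *)

Section Runs.
Context {Sigma : finType}.

(** An augmented letter carries states of all the automata, also of those that reject the column:
    completeness supplies a run in any case, and an accepting one is chosen if there is one. *)
Lemma complete_accepting_run (A : automaton Sigma) (x : nat -> Sigma) :
  complete A -> exists r : nat -> state A,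
    [/\ r 0 = start A, forall t, r t.+1 \in trans (r t) (x t)
      & omega_lang A x -> infinitely_often (fun t => r t \in final A)].
Proof.
move=> cA; have [[r [r0 rS rF]]|nx] := pselect (omega_lang A x).
  by exists r.
by have [r [r0 rS]] := complete_run A x cA; exists r.
Qed.

Context {k : nat} {A nA : 'I_k -> automaton Sigma}.
Variable lep : 'I_k -> set (nat -> Sigma).
Hypotheses (A_complete : forall i, complete (A i))
  (A_lep : forall i, omega_lang (A i) = lep i)
  (nA_complete : forall i, complete (nA i))
  (nA_lep : forall i, omega_lang (nA i) = ~` lep i).

(** With the true sets as guesses, every selected automaton accepts, so every property is confirmed
    infinitely often in every column. *)
Lemma synchronized_runs (n : nat) (x : nat -> 'I_n -> Sigma) :
  exists y : nat -> 'I_n -> aug_letter A nA,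
    [/\ forall t j, proj_letter (y t j) = x t j,
        forall j, y 0 j = start_letter A nA (x 0 j) (lep_set lep (x^~ j)),
        forall t j, aug_step (y t j) (y t.+1 j)
      & infinitely_often (fun t => forall j, flag (y t j))].
Proof.
pose pos j i := cid (complete_accepting_run _ (x^~ j) (A_complete i)).
pose neg j i := cid (complete_accepting_run _ (x^~ j) (nA_complete i)).
pose p t j := [ffun i => sval (pos j i) t] : {dffun forall i, state (A i)}.
pose np t j := [ffun i => sval (neg j i) t] : {dffun forall i, state (nA i)}.
pose L j := lep_set lep (x^~ j).
pose conf t j := [set i | if i \in L j then p t j i \in final (A i)
                          else np t j i \in final (nA i)]%SET.
pose full t := [forall j, collect conf t j == finset.setT].
(* The flag lags by one: it marks the word reached by leaving a full configuration, and is [noreset]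
   at time [0] as [start_letter] demands. *)
pose fl t := if t is t'.+1 then full t' else false.
pose y t j : aug_letter A nA :=
  (x t j, p t j, np t j, L j, collect conf t j, fl t).
exists y; split=> [//|j|t j|].
- rewrite /start_letter /y /=; congr (_, _, _, _, _, _).
    by apply/ffunP => i; rewrite !ffunE; case: (svalP (pos j i)).
  by apply/ffunP => i; rewrite !ffunE; case: (svalP (neg j i)).
- rewrite aug_stepE /pos_states /neg_states /guess /collected /= -/(full t).
  rewrite eqxx; apply/and4P; split=> //.
  + by apply/forallP => i; rewrite !ffunE; case: (svalP (pos j i)).
  + by apply/forallP => i; rewrite !ffunE; case: (svalP (neg j i)).
  case: (boolP (full t)) => [/forallP/(_ j)->|_]; first by rewrite eqxx.
  (* A column may be full before the others: its union is then still everything, which is the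
     waiting branch of [aug_step]. *)
  by rewrite andbT; case: ifP => [/eqP->|_]; rewrite ?finset.setTU !eqxx ?orbT.
- have inf : infinitely_often full.
    apply: collect_full_infinitely_often => j i m.
    have [iL|iL] := boolP (i \in L j).
      have lepx : omega_lang (A i) (x^~ j).
        by rewrite A_lep; move: iL; rewrite inE => /asboolP.
      have [_ _ /(_ lepx)/(_ m)[t mt pt]] := svalP (pos j i).
      by exists t; rewrite // inE iL ffunE.
    have lepx : omega_lang (nA i) (x^~ j).
      by rewrite nA_lep; move: iL; rewrite inE => /asboolPn.
    have [_ _ /(_ lepx)/(_ m)[t mt pt]] := svalP (neg j i).
    by exists t; rewrite // inE (negPf iL) ffunE.
  by move=> m; have [t mt ft] := inf m; exists t.+1; rewrite ?leqW.
Qed.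

End Runs.

Theorem theorem30 (Sigma : finType) (M : regular_system Sigma) (k : nat)
    (lep : 'I_k -> set (nat -> Sigma)) (A nA : 'I_k -> automaton Sigma)
    (losp : set (seq {set 'I_k})) (B : automaton {set 'I_k})
    (A_complete : forall i, complete (A i))
    (A_lep : forall i, omega_lang (A i) = lep i)
    (nA_complete : forall i, complete (nA i))
    (nA_lep : forall i, omega_lang (nA i) = ~` lep i)
    (B_losp : lang B = losp) :
  (forall wa : nat -> seq (aug_letter A nA),
     bs_execution (aug_system A nA M losp) wa ->
     bs_accepting (aug_system A nA M losp) wa ->
     rs_execution M (fun i => proj_word (wa i)) /\
     ~ satisfies lep losp (fun i => proj_word (wa i)))
  /\
  (forall w : nat -> seq Sigma,
     rs_execution M w -> ~ satisfies lep losp w ->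
     exists wa : nat -> seq (aug_letter A nA),
       [/\ bs_execution (aug_system A nA M losp) wa,
           bs_accepting (aug_system A nA M losp) wa
         & forall i, proj_word (wa i) = w i]).
Proof.
split=> [wa exec acc | w exec unsat].
  have [n [x wax]] := execution_columns exec.
  case: exec => -[w [L [S0w nL szwL wa0]]] R.
  have step t j : aug_step (x t j) (x t.+1 j).
    have [_] := (relation_of_aug_transducer _ _ _).1 (R t).
    by rewrite wax all2_map_same => /allP; apply; rewrite mem_enum.
  have resets j : infinitely_often (fun t => flag (x t j)).
    move=> m; have [t mt] := acc m; rewrite /= /aug_final /= wax all_map.
    by move=> /allP/(_ j); rewrite mem_enum => /(_ isT) /eqP; exists t.
  have start j : exists a K, x 0 j = start_letter A nA a K.
    have : x 0 j \in wa 0 by rewrite wax map_f ?mem_enum.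
    by rewrite wa0 => /mapP[z _ ->]; exists z.1, z.2.
  have projE : (fun t => proj_word (wa t)) =
      columns (fun t j => proj_letter (x t j)).
    by apply/funext => t; rewrite wax /proj_word /columns -map_comp.
  split.
    split=> [|t]; last by have [] := (relation_of_aug_transducer _ _ _).1 (R t).
    rewrite wa0 /proj_word -map_comp (_ : map _ _ = w) //.
    by rewrite -[RHS](unzip1_zip (t := L)) ?szwL.
  rewrite /satisfies projE lep_word_columns.
  (* The word [L] outside [losp] is read off the initial letters, where [lep_set_guess] identifies
     it with the true word of local properties. *)
  have LE : L = map guess (wa 0).
    by rewrite wa0 -map_comp -[LHS](unzip2_zip (s := w)) ?szwL.
  move: nL; rewrite LE wax /columns -map_comp.
  suff -> : [seq lep_set lep (fun t => proj_letter (x t j)) | j <- enum 'I_n] =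
      [seq (guess \o x 0) j | j <- enum 'I_n] by [].
  apply: eq_map => j.
  exact: (lep_set_guess (x^~ j)).
have [n [x wx]] := execution_columns exec.
have [y [projy y0 step resets]] :=
  synchronized_runs lep A_complete A_lep nA_complete nA_lep n x.
have projE t : proj_word (columns y t) = w t.
  by rewrite wx /proj_word -map_comp; apply: eq_map => j /=.
case: exec => S0w R; exists (columns y); split=> //; last first.
  move=> m; have [t mt ft] := resets m; exists t => //=.
  by rewrite /aug_final /= all_map; apply/allP => j _ /=; rewrite ft.
split=> [|t].
  (* The true word is the guess; it lies outside [losp] precisely because [w] violates the
     property. *)
  exists (w 0), (lep_word lep w); split=> //.
    by rewrite size_map size_enum_ord.
  rewrite wx lep_word_columns /columns zip_map -map_comp.
  by apply: eq_map => j; rewrite y0.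
apply/relation_of_aug_transducer; rewrite !projE; split=> //.
by rewrite all2_map_same; apply/allP => j _; apply: step.
Qed.
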